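(* Let $S$ be a left reversible regular semigroup with a finite choice of generators $X$. If $S$ has maximal global cogrowth (with respect to $X$) then $S$ is left amenable.
   Context: A semigroup $S$ is regular if for every $s\in S$ there is $t\in S$ with $sts=s$. $S$ is left reversible if it does not admit disjoint (non-empty) right ideals. A finite choice of generators for a semigroup $S$ is a finite set $X$ of symbols together with a surjective morphism $X^+\to S$, $w\mapsto\overline{w}$, from the free semigroup on $X$; $|w|$ is the length of a word $w$. The global cogrowth function $\gamma^{S,X}(n)$ ($n\geq1$) is the number of pairs $(u,v)$ of non-empty words over $X$ with $|u|+|v|=n$ and $\overline{u}=\overline{v}$ in $S$. The global cogrowth rate is $\gamma^{S,X}=\limsup_{n\to\infty}(\gamma^{S,X}(n))^{1/n}\leq|X|$; $S$ has maximal global cogrowth (with respect to $X$) if $\gamma^{S,X}=|X|$. $S$ is left amenable if there is a finitely additive probability measure $\mu$, defined on all subsets of $S$, such that $\mu(a^{-1}Y)=\mu(Y)$ for all $Y\subseteq S$ and $a\in S$, where $a^{-1}Y=\{s\in S: as\in Y\}$. *)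

(* Defs.v *)
From HB Require Import structures.
From mathcomp Require Import all_boot all_order all_algebra finmap.
From mathcomp Require Import all_classical all_reals all_analysis.

Set Implicit Arguments.
Unset Strict Implicit.
Unset Printing Implicit Defensive.

Import Order.TTheory GRing.Theory Num.Theory.
Local Open Scope classical_set_scope.
Local Open Scope ring_scope.

Definition regular (S : semigroupType) :=
  forall s : S, exists t : S, (s * t * s)%g = s.

Definition right_ideal (S : semigroupType) (I : set S) :=
  I !=set0 /\ forall x s : S, I x -> I (x * s)%g.

Definition left_reversible (S : semigroupType) :=
  ~ exists I J : set S, [/\ right_ideal I, right_ideal J & I `&` J = set0].

(* The free semigroup on X, usually written X^+: the non-empty words over X,
   under concatenation. *)
Record free_semigroup (X : Type) :=
  FreeSemigroup { word : seq X; word_gt0 : (0 < size word)%N }.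

HB.instance Definition _ (X : Type) := [isSub for @word X].
HB.instance Definition _ (X : choiceType) :=
  [Choice of free_semigroup X by <:].

Lemma free_mul_subproof (X : Type) (u v : free_semigroup X) :
  (0 < size (word u ++ word v))%N.
Proof. by rewrite size_cat addn_gt0 word_gt0. Qed.

Definition free_mul (X : Type) (u v : free_semigroup X) : free_semigroup X :=
  FreeSemigroup (free_mul_subproof u v).

Lemma free_mulA (X : Type) : associative (@free_mul X).
Proof. by move=> u v w; apply: val_inj; rewrite /= catA. Qed.

HB.instance Definition _ (X : choiceType) :=
  isSemigroup.Build (free_semigroup X) (@free_mulA X).

Definition wlength (X : Type) (w : free_semigroup X) : nat := size (word w).

Definition choice_of_generators (S : semigroupType) (X : finType)
    (ev : {multiplicative free_semigroup X -> S}) :=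
  forall s : S, exists w : free_semigroup X, ev w = s.

Definition cogrowth_pairs (S : semigroupType) (X : finType)
    (ev : {multiplicative free_semigroup X -> S}) (n : nat) :
    set (free_semigroup X * free_semigroup X) :=
  [set p | (wlength p.1 + wlength p.2)%N = n /\ ev p.1 = ev p.2].

(* [fset_set A] is empty when A is infinite; this never happens below. *)
Lemma finite_cogrowth_pairs (S : semigroupType) (X : finType)
    (ev : {multiplicative free_semigroup X -> S}) (n : nat) :
  finite_set (cogrowth_pairs ev n).
Proof.
pose toseq (t : {k : 'I_n.+1 & k.-tuple X}) : seq X := tval (tagged t).
have finw : finite_set [set w : free_semigroup X | (wlength w <= n)%N].
  pose ws : seq (free_semigroup X) := pmap insub (map toseq (enum predT)).
  apply: sub_finite_set (finite_seq ws) => w /= wn.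
  rewrite mem_pmap_sub /=; apply/mapP.
  have wn1 : (size (word w) < n.+1)%N by [].
  by exists (existT _ (Ordinal wn1) (in_tuple (word w))); rewrite ?mem_enum.
apply: sub_finite_set (finite_setX finw finw) => -[u v] /= [<- _] /=.
by split; [exact: leq_addr | exact: leq_addl].
Qed.

Definition global_cogrowth (S : semigroupType) (X : finType)
    (ev : {multiplicative free_semigroup X -> S}) (n : nat) : nat :=
  #|` fset_set (cogrowth_pairs ev n)|.

(* The term n = 0 is irrelevant to the limsup. *)
Definition global_cogrowth_rate (R : realType) (S : semigroupType)
    (X : finType) (ev : {multiplicative free_semigroup X -> S}) : \bar R :=
  limn_esup (fun n => ((global_cogrowth ev n)%:R `^ (n%:R^-1))%:E).

Definition maximal_global_cogrowth (R : realType) (S : semigroupType)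
    (X : finType) (ev : {multiplicative free_semigroup X -> S}) :=
  global_cogrowth_rate R ev = (#|X|%:R)%:E.

Definition finitely_additive_probability (R : realType) (T : Type)
    (mu : set T -> R) :=
  [/\ forall A : set T, 0 <= mu A,
      mu setT = 1 &
      forall A B : set T, A `&` B = set0 -> mu (A `|` B) = mu A + mu B].

Definition left_amenable (R : realType) (S : semigroupType) :=
  exists mu : set S -> R, finitely_additive_probability mu /\
    forall (a : S) (Y : set S), mu ((fun s => (a * s)%g) @^-1` Y) = mu Y.

(* Main.v *)
Require Import Defs.
From mathcomp Require Import all_boot all_order all_algebra finmap.
From mathcomp Require Import all_classical all_reals all_analysis.
From mathcomp Require Import lra ring.

Set Implicit Arguments.
Unset Strict Implicit.
Unset Printing Implicit Defensive.

Import Order.TTheory GRing.Theory Num.Theory.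
Import numFieldNormedType.Exports.
Local Open Scope classical_set_scope.
Local Open Scope ring_scope.

(** Two words are identified when their actions on [S] by left multiplication
agree at some point.  Left reversibility makes this a congruence, and
regularity makes it left cancellative ([weq_cancel]) with a non-empty word
acting as an identity ([weq_unit_word]): the classes form the maximal group
image [G] of [S].  The group itself need not be formed: a finite set of
coincidences in [G] is realised in [S] at a single point [z]
([exists_resolves]), so that [w |-> w z] embeds in [S] any ball of [G] that is
needed.

Let [N] be the number of generators, and let [f_k] be the function on [G] that
counts the words of length [k] representing an element.  The pairs counted by
the cogrowth function coincide in [G] too, so the cogrowth at [n] is at most
the sum over [i + j = n] of the inner products of [f_i] and [f_j].  If, for some
[eta > 0] and some [m > 0], the squared norm of [f_(k+m)] were at most [(1 - eta) N^(2m)] times that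
of [f_k] for every [k], these inner products would grow geometrically with
ratio less than [N], against maximality.  So some [k] makes this ratio of
squared norms almost [N^(2m)] ([weq_count_almost_norming]).

As [f_(k+m)] is the sum of the [N^m] translates of [f_k] by words of length
[m], all of the same norm, each two of these translates are then almost equal
([translate_coinc_large]).  Squaring and normalising [f_k] gives a probability
measure whose translates by two words of length [m] are close in total
variation ([coinc_in_dist]).  Take for [m] the length of a word acting as the
identity.  By cancellation, translates by two words of the same length at most
[m] are close as well, and those by words of length [m] are close to the measure
itself.  So the average of the translates by [x0^i], [i < m], is almost
invariant under every generator ([exists_almost_invariant]).  Evaluated at [z]
this is a finitely additive probability on [S], and a limit along an
ultrafilter is invariant. *)

(** * The action of words, and the right cancellative quotient *)

Definition wact (S : semigroupType) (X : Type) (g : X -> S) (w : seq X)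
    (s : S) : S := foldr (fun x t => (g x * t)%g) s w.

(** For [S] left reversible this is equality in the largest right cancellative
quotient of [S], of the elements represented by the two words. *)
Definition weq (S : semigroupType) (X : Type) (g : X -> S) (w w' : seq X) :=
  exists s, wact g w s = wact g w' s.

Section WordAction.
Variables (S : semigroupType) (X : finType) (g : X -> S).
Implicit Types (u v w : seq X) (s t z : S).

Lemma wact_mulr w s t : wact g w (s * t)%g = (wact g w s * t)%g.
Proof. by elim: w => //= x w ->; rewrite mulgA. Qed.

Lemma wact_cat u v s : wact g (u ++ v) s = wact g u (wact g v s).
Proof. by rewrite /wact foldr_cat. Qed.

Hypothesis revS : left_reversible S.

Lemma common_right_multiple s t : exists p q, (s * p = t * q)%g.
Proof.
apply: contrapT => nst; apply: revS.
have idl r : right_ideal [set (r * p)%g | p in [set: S]].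
  split; first by exists (r * r)%g, r.
  by move=> _ p [q _ <-]; exists (q * p)%g => //; rewrite mulgA.
exists [set (s * p)%g | p in [set: S]], [set (t * q)%g | q in [set: S]].
split => //; apply/seteqP; split => // r [[p _ <-] [q _ qp]].
by apply: nst; exists p, q.
Qed.

(** A coincidence at [y] persists at every right multiple of [y], and finitely
many principal right ideals have a common element. *)
Lemma weq_common_witness (s0 : S) (r : seq (seq X * seq X)) :
  (forall p, p \in r -> weq g p.1 p.2) ->
  exists z, forall p, p \in r -> wact g p.1 z = wact g p.2 z.
Proof.
elim: r => [|p r IHr] h; first by exists s0.
have [y ye] := h p (mem_head p r).
have [z ze] := IHr (fun q qr => h q (mem_behead (s := p :: r) qr)).
have [a [b yazb]] := common_right_multiple y z.
exists (y * a)%g => q; rewrite inE => /predU1P[->|qr].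
  by rewrite !wact_mulr ye.
by rewrite yazb !wact_mulr ze.
Qed.

Hypothesis regS : regular S.

(** In the group image every idempotent becomes the identity. *)
Lemma idempotent_fixes (e p : S) :
  (e * e = e)%g -> exists t, (e * (p * t) = p * t)%g.
Proof.
move=> ee; have [a [b eapb]] := common_right_multiple e p.
by exists b; rewrite -eapb mulgA ee.
Qed.

(** Multiply by an inverse [a'] of [a]: the idempotent [a' * a] fixes suitable
right multiples of [p] and of [q]. *)
Lemma mul_cancel_right_multiple (a p q : S) :
  (a * p = a * q)%g -> exists t, (p * t = q * t)%g.
Proof.
move=> apq; have [a' aa'a] := regS a.
have ee : ((a' * a) * (a' * a) = a' * a)%g.
  by rewrite -mulgA; congr (_ * _)%g; rewrite mulgA.
have [t pt] := idempotent_fixes p ee.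
have [t' qt'] := idempotent_fixes q ee.
have [b [b' tb]] := common_right_multiple t t'.
exists (t * b)%g.
have pE : (p * (t * b) = a' * (a * p) * (t * b))%g.
  by rewrite (mulgA p) -pt !mulgA.
have qE : (q * (t * b) = a' * (a * q) * (t * b))%g.
  by rewrite tb (mulgA q) -qt' !mulgA.
by rewrite pE qE apq.
Qed.

Lemma weq_cancel u w w' : weq g (u ++ w) (u ++ w') -> weq g w w'.
Proof.
elim: u => [//|x u IHu] [s /= xs]; apply: IHu.
have [t tE] := mul_cancel_right_multiple xs.
by exists (s * t)%g; rewrite !wact_mulr.
Qed.

Hypothesis gen : forall s, exists w, w != [::] /\ forall t, wact g w t = (s * t)%g.

(** Any word for an idempotent will do. *)
Lemma weq_unit_word (s0 : S) :
  exists e : seq X, e != [::] /\ forall w, weq g (e ++ w) w.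
Proof.
have [t sts] := regS s0; have [e [e0 eE]] := gen (s0 * t)%g.
exists e; split=> // w.
have ee : ((s0 * t) * (s0 * t) = s0 * t)%g by rewrite mulgA sts.
have [p pE] := idempotent_fixes (wact g w s0) ee.
by exists (s0 * p)%g; rewrite wact_cat eE wact_mulr.
Qed.

End WordAction.

(** * Words of a given length *)

(** Lists rather than tuples, so that concatenation needs no casts. *)
Fixpoint words (X : finType) (n : nat) : seq (seq X) :=
  if n is n'.+1 then [seq x :: w | x <- enum X, w <- words X n'] else [:: [::]].

Section Words.
Variable X : finType.

Lemma mem_words n (w : seq X) : (w \in words X n) = (size w == n).
Proof.
elim: n w => [|n IHn] [|x w] //=.
  by apply/negbTE/negP => /allpairsP[[y v] []].
rewrite eqSS -IHn; apply/allpairsP/idP => [[[y v] /= [_ vn [_ ->]]] //|wn].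
by exists (x, w); rewrite mem_enum.
Qed.

Lemma words_uniq n : uniq (words X n).
Proof.
elim: n => //= n IHn; apply: allpairs_uniq => //; first exact: enum_uniq.
by move=> [x w] [y v] _ _ /= [-> ->].
Qed.

Lemma size_words n : size (words X n) = (#|X| ^ n)%N.
Proof. by elim: n => //= n IHn; rewrite size_allpairs IHn -cardE expnS. Qed.

Lemma big_words_cat (R : nmodType) m k (F : seq X -> R) :
  \sum_(w <- words X (m + k)) F w =
  \sum_(u <- words X m) \sum_(v <- words X k) F (u ++ v).
Proof.
elim: m F => [|m IHm] F; first by rewrite big_seq1.
rewrite addSn /= !big_allpairs_dep; apply: eq_bigr => x _.
by rewrite IHm.
Qed.

End Words.

(** * Counting coincidences *)

(** The inner product of the two functions on [T] that count the preimages
under [a] in [r] and under [b] in [q]. *)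
Definition coinc (R : realType) (T I : eqType) (r q : seq I) (a b : I -> T) : R :=
  \sum_(i <- r) \sum_(j <- q) (a i == b j)%:R.

(** The mass on [Y] of the measure whose density is the square of the function
counting preimages under [a]. *)
Definition coinc_in (R : realType) (T I : eqType) (r : seq I) (a : I -> T)
    (Y : set T) : R :=
  \sum_(i <- r) \sum_(j <- r) (a i == a j)%:R * (`[< Y (a i) >])%:R.

Section Coincidences.
Variables (R : realType) (T I : eqType).
Implicit Types (r q : seq I) (a b : I -> T) (D : seq T).

Let cnt r a s : R := \sum_(i <- r) (a i == s)%:R.

Lemma sum_coincidences D r q a b (h : T -> R) : uniq D ->
  {in r, forall i, a i \in D} ->
  \sum_(i <- r) \sum_(j <- q) (a i == b j)%:R * h (a i) =
  \sum_(s <- D) cnt r a s * cnt q b s * h s.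
Proof.
move=> uD rD; rewrite /cnt.
under [RHS]eq_bigr do rewrite -mulrA mulr_suml.
rewrite [RHS]exchange_big /= big_seq [RHS]big_seq; apply: eq_bigr => i ir.
rewrite (bigD1_seq (a i)) ?rD//= eqxx mul1r [X in _ = _ + X]big1 ?addr0; last first.
  by move=> s sa; rewrite eq_sym (negbTE sa) mul0r.
by rewrite mulr_suml; apply: eq_bigr => j _; rewrite eq_sym.
Qed.

Lemma coincE D r q a b : uniq D -> {in r, forall i, a i \in D} ->
  coinc R r q a b = \sum_(s <- D) cnt r a s * cnt q b s.
Proof.
move=> uD rD.
have := @sum_coincidences D r q a b (fun=> 1) uD rD.
rewrite (eq_bigr (fun s => cnt r a s * cnt q b s)); last first.
  by move=> s _; rewrite mulr1.
by move=> <-; do 2!apply: eq_bigr => ? _; rewrite mulr1.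
Qed.

Let images r q a b := undup (map a r ++ map b q).

Let images_uniq r q a b : uniq (images r q a b).
Proof. exact: undup_uniq. Qed.

Let mem_imagesl r q a b : {in r, forall i, a i \in images r q a b}.
Proof. by move=> i ir; rewrite mem_undup mem_cat map_f. Qed.

Let mem_imagesr r q a b : {in q, forall i, b i \in images r q a b}.
Proof. by move=> i ir; rewrite mem_undup mem_cat orbC map_f. Qed.

(** Summing [0 <= t * (x - y / t) ^+ 2].  This weighted form serves as the
Cauchy-Schwarz inequality, for the right choice of [t]. *)
Lemma coinc_AMGM r q a b (t : R) : 0 < t ->
  2 * coinc R r q a b <= t * coinc R r r a a + t^-1 * coinc R q q b b.
Proof.
move=> t0; have uD := images_uniq r q a b.
have aD := @mem_imagesl r q a b; have bD := @mem_imagesr r q a b.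
rewrite (coincE q b uD aD) (coincE r a uD aD) (coincE q b uD bD).
rewrite !mulr_sumr -big_split /=; apply: ler_sum => s _.
move: (cnt r a s) (cnt q b s) => x y; rewrite -subr_ge0.
have -> : t * (x * x) + t^-1 * (y * y) - 2 * (x * y) = t * (x - y / t) ^+ 2.
  by field; rewrite gt_eqF.
by rewrite mulr_ge0 ?sqr_ge0// ltW.
Qed.

(** Two functions [x] and [y] of squared norm [c] with inner product almost [c]
have squares that are close in the sum norm: [x^2 - y^2] factors, and
[2 t |x - y| (x + y) <= (x - y)^2 + t^2 (x + y)^2]. *)
Lemma coinc_in_dist r a b (c t : R) (Y : set T) : 0 < t ->
  coinc R r r a a = c -> coinc R r r b b = c ->
  (1 - t ^+ 2) * c <= coinc R r r a b ->
  `|coinc_in R r a Y - coinc_in R r b Y| <= 3 * t * c.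
Proof.
move=> t0 aa bb ab; have uD := images_uniq r r a b.
have aD := @mem_imagesl r r a b; have bD := @mem_imagesr r r a b.
have abc : coinc R r r a b <= c.
  have := coinc_AMGM r r a b (@ltr01 R); rewrite aa bb invr1; lra.
have key : 2 * t * `|coinc_in R r a Y - coinc_in R r b Y| <=
    (c + c - 2 * coinc R r r a b) + t ^+ 2 * (c + c + 2 * coinc R r r a b).
  rewrite /coinc_in (@sum_coincidences _ r r a a (fun s => (`[< Y s >])%:R) uD aD).
  rewrite (@sum_coincidences _ r r b b (fun s => (`[< Y s >])%:R) uD bD).
  have -> : c + c = coinc R r r a a + coinc R r r b b by rewrite aa bb.
  rewrite (coincE _ _ uD aD) (coincE _ _ uD aD) (coincE _ _ uD bD).
  have t20 : 0 <= 2 * t by rewrite mulr_ge0// ltW.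
  rewrite -sumrB; apply: (le_trans (ler_wpM2l t20 (ler_norm_sum _ _ _))).
  rewrite !mulr_sumr -!big_split -sumrB mulr_sumr -big_split /=.
  apply: ler_sum => s _.
  have xs0 : 0 <= cnt r a s by apply: sumr_ge0.
  have ys0 : 0 <= cnt r b s by apply: sumr_ge0.
  move: (cnt r a s) (cnt r b s) xs0 ys0 => x y x0 y0.
  rewrite -mulrBl normrM (_ : x * x - y * y = (x - y) * (x + y)); last by ring.
  rewrite normrM (ger0_norm (addr_ge0 x0 y0)).
  apply: le_trans (_ : _ <= 2 * t * (`|x - y| * (x + y))) _.
    rewrite ler_wpM2l// ler_piMr ?mulr_ge0 ?addr_ge0//.
    by case: `[< _ >]; rewrite ?normr1 ?normr0.
  have := sqr_ge0 (`|x - y| - t * (x + y)).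
  have : `|x - y| ^+ 2 = (x - y) ^+ 2 by rewrite real_normK ?num_real.
  move: `|x - y| => d; nra.
have c0 : 0 <= c by rewrite -aa; do 2!apply: sumr_ge0 => ? _.
suff : 2 * t * `|coinc_in R r a Y - coinc_in R r b Y| <= 2 * t * (3 * t * c).
  by rewrite ler_pM2l// mulr_gt0.
move: key ab abc; move: (`|_|) (coinc _ _ _ _ _) => d M; nra.
Qed.

End Coincidences.

(** * Geometric growth *)

Section Growth.
Variable R : realType.

Lemma bernoulli_ineq (a : R) n : -1 <= a -> 1 + n%:R * a <= (1 + a) ^+ n.
Proof.
move=> a1; elim: n => [|n IHn]; first by rewrite mul0r addr0 expr0.
rewrite exprS; apply: le_trans (_ : _ <= (1 + a) * (1 + n%:R * a)) _; last first.
  by rewrite ler_wpM2l//; lra.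
have := sqr_ge0 a; have := ler0n R n; rewrite -natr1; nra.
Qed.

(** The constant takes care of the [m] initial values. *)
Lemma geometric_bound (c : nat -> R) (m : nat) (q : R) : (0 < m)%N -> 0 < q ->
  (forall k, 0 <= c k) -> (forall k, c (k + m)%N <= q ^+ m * c k) ->
  exists2 C, 0 <= C & forall k, c k <= C * q ^+ k.
Proof.
move=> m0 q0 c0 cm; exists (\sum_(i < m) c i / q ^+ i).
  by apply: sumr_ge0 => i _; rewrite divr_ge0// exprn_ge0// ltW.
elim/ltn_ind => k IHk; have [km|mk] := ltnP k m.
  rewrite -ler_pdivrMr ?exprn_gt0//.
  rewrite (bigD1 (Ordinal km))//= lerDl; apply: sumr_ge0 => i _.
  by rewrite divr_ge0// exprn_ge0// ltW.
rewrite -(subnK mk); apply: le_trans (cm _) _.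
rewrite addnC exprD mulrCA ler_wpM2l ?(exprn_ge0 _ (ltW q0))//.
by apply: IHk; rewrite ltn_subrL m0 (leq_trans m0 mk).
Qed.

(** The linear factor is absorbed by enlarging the ratio [p] slightly (to [p1]),
and the constant by enlarging it once more (to [p2]). *)
Lemma limn_esup_root_lt (g : nat -> R) (C p N : R) : 0 < p -> p < N -> 0 <= C ->
  (forall n, 0 <= g n <= n.+1%:R * C * p ^+ n) ->
  (limn_esup (fun n => (g n `^ (n%:R^-1))%:E) < N%:E)%E.
Proof.
move=> p0 pN C0 gC; pose d := (N - p) / 3.
have d0 : 0 < d by rewrite divr_gt0// subr_gt0.
pose p1 := p + d; pose p2 := p + d + d.
have p10 : 0 < p1 by rewrite addr_gt0.
have p20 : 0 < p2 by rewrite addr_gt0.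
have p2N : p2 < N by rewrite /p2 /d; lra.
pose h := d / p; have h0 : 0 < h by rewrite divr_gt0.
have [A A0 nA] : exists2 A, 0 <= A & forall n, n.+1%:R * p ^+ n <= A * p1 ^+ n.
  exists (1 + h^-1); first by rewrite addr_ge0// invr_ge0 ltW.
  move=> n; have -> : p1 = p * (1 + h) by rewrite /p1 /h; field; rewrite gt_eqF.
  rewrite exprMn mulrCA mulrC ler_wpM2l ?(exprn_ge0 _ (ltW p0))//.
  have B := @bernoulli_ineq h n (ltW (lt_trans (ltrN10 R) h0)).
  have B1 : 1 <= (1 + h) ^+ n.
    by apply: le_trans B; rewrite lerDl mulr_ge0// ltW.
  have : n%:R <= h^-1 * (1 + h) ^+ n.
    rewrite mulrC ler_pdivlMr//; lra.
  rewrite -natr1; lra.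
have s1 : `|p1 / p2| < 1.
  by rewrite ger0_norm ?divr_ge0 ?ltW// ltr_pdivrMr// mul1r /p1 /p2 ltrDl.
have evs : \forall n \near \oo, A * C * (p1 / p2) ^+ n <= 1.
  have : (A * C * (p1 / p2) ^+ n) @[n --> \oo] --> A * C * 0.
    by apply: cvgMr; exact: cvg_expr.
  rewrite mulr0 => cv0.
  by apply: filterS (cvgr_lt _ cv0 _ ltr01) => n /ltW.
have evg : \forall n \near \oo, g n `^ (n%:R^-1) <= p2.
  near=> n; have n0 : (0 < n)%N by near: n; exists 1%N.
  have gp : g n <= p2 ^+ n.
    have /andP[_ /le_trans->//] := gC n.
    rewrite mulrAC; apply: le_trans (_ : _ <= A * p1 ^+ n * C) _.
      by rewrite ler_wpM2r.
    rewrite -[leRHS]mul1r -ler_pdivrMr ?exprn_gt0// (mulrAC A) -(mulrA (A * C)) -expr_div_n.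
    by near: n.
  apply: le_trans (_ : _ <= (p2 ^+ n) `^ n%:R^-1) _.
    have /andP[g0 _] := gC n.
    by apply: ge0_ler_powR => //; rewrite ?nnegrE ?invr_ge0 ?(exprn_ge0 _ (ltW p20)).
  rewrite -powR_mulrn ?(ltW p20)// -powRrM mulfV ?pnatr_eq0 -?lt0n//.
  by rewrite powRr1// ltW.
apply: le_lt_trans (_ : _ <= p2%:E)%E _; last by rewrite lte_fin.
rewrite /limn_esup limf_esupE.
set V := [set n | g n `^ (n%:R^-1) <= p2] in evg.
apply: (@le_trans _ _ (ereal_sup [set (g n `^ (n%:R^-1))%:E | n in V])).
  by apply: ereal_inf_lbound; exists V.
by apply: ge_ereal_sup => _ [n /= gn <-]; rewrite lee_fin.
Unshelve. all: by end_near. Qed.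
End Growth.

(** * Coincidence counts of words *)

Section CoincidenceCounts.
Variables (R : realType) (S : semigroupType) (X : finType) (g : X -> S).
Implicit Types (u v w : seq X) (s t z : S).

(** The inner product of [f_k] and [f_l]. *)
Definition weq_count (k l : nat) : R :=
  \sum_(w <- words X k) \sum_(w' <- words X l) (`[< weq g w w' >])%:R.

(** At such a point [z] the map [w |-> w z] identifies two words of length at
most [K] only if they are equal in the group image. *)
Definition resolves (K : nat) (z : S) := forall w w',
  (size w <= K)%N -> (size w' <= K)%N -> weq g w w' ->
  wact g w z = wact g w' z.

Definition translate z u : seq X -> S := fun w => wact g (u ++ w) z.

Lemma resolves_weq K z w w' : resolves K z ->
  (size w <= K)%N -> (size w' <= K)%N ->
  `[< weq g w w' >] = (wact g w z == wact g w' z).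
Proof.
move=> zK wK w'K; apply/asboolP/eqP; first exact: zK.
by move=> e; exists z.
Qed.

Lemma weq_countE K z k l : resolves K z -> (k <= K)%N -> (l <= K)%N ->
  weq_count k l = \sum_(w <- words X k) \sum_(w' <- words X l)
    (wact g w z == wact g w' z)%:R.
Proof.
move=> zK kK lK; rewrite /weq_count big_seq [RHS]big_seq.
apply: eq_bigr => w; rewrite mem_words => /eqP wk.
rewrite big_seq [RHS]big_seq; apply: eq_bigr => w'; rewrite mem_words => /eqP wl.
by rewrite (resolves_weq zK)// ?wk ?wl.
Qed.

Lemma weq_count_ge0 k l : 0 <= weq_count k l.
Proof. by do 2!apply: sumr_ge0 => ? _. Qed.

Lemma weq_count_gt0 k : (0 < #|X|)%N -> 0 < weq_count k k.
Proof.
case/card_gt0P => x _; have xk : nseq k x \in words X k by rewrite mem_words size_nseq.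
rewrite /weq_count (bigD1_seq _ xk (words_uniq X k))/=.
rewrite (bigD1_seq _ xk (words_uniq X k))/= asboolT; last first.
  by exists (wact g [::] (g x)).
rewrite -addrA ltr_pwDl// addr_ge0//; first exact: sumr_ge0.
by do 2!apply: sumr_ge0 => ? _.
Qed.

Hypothesis revS : left_reversible S.
Variable s0 : S.

Lemma exists_resolves K : exists z, resolves K z.
Proof.
pose ws := [seq w | i <- iota 0 K.+1, w <- words X i].
have wsP w : (size w <= K)%N -> w \in ws.
  move=> wK; apply/allpairsPdep; exists (size w), w.
  by rewrite mem_iota mem_words eqxx.
pose r := [seq p <- [seq (w, w') | w <- ws, w' <- ws] | `[< weq g p.1 p.2 >] ].
have [|z zP] := @weq_common_witness S X g revS s0 r.
  by move=> p; rewrite mem_filter => /andP[/asboolP].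
exists z => w w' wK w'K ww'; apply: (zP (w, w')).
rewrite mem_filter; apply/andP; split; first exact/asboolP.
by apply/allpairsP; exists (w, w'); split => //; exact: wsP.
Qed.

Lemma weq_count_AMGM k l (t : R) : 0 < t ->
  2 * weq_count k l <= t * weq_count k k + t^-1 * weq_count l l.
Proof.
move=> t0; have [z zK] := exists_resolves (maxn k l).
rewrite !(weq_countE zK) ?leq_maxl ?leq_maxr//.
exact: (coinc_AMGM (words X k) (words X l) (wact g ^~ z) (wact g ^~ z) t0).
Qed.

(** Otherwise the norm of [f_k] is at most a multiple of [p ^+ k] with
[p < #|X|], hence so is the inner product of [f_i] and [f_j] for [k = i + j],
and [gam] is too small. *)
Lemma weq_count_almost_norming (gam : nat -> R) (m : nat) (eta : R) :
  (0 < #|X|)%N -> (0 < m)%N -> 0 < eta ->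
  (forall n, 0 <= gam n <= \sum_(i < n.+1) weq_count i (n - i)) ->
  limn_esup (fun n => (gam n `^ (n%:R^-1))%:E) = (#|X|%:R)%:E ->
  exists k, (1 - eta) * #|X|%:R ^+ (m + m) * weq_count k k <=
    weq_count (k + m) (k + m).
Proof.
move=> X0 m0 eta0 gamP limN; set N : R := #|X|%:R.
have N0 : 0 < N by rewrite ltr0n.
apply: contrapT => /forallNP H.
have {}H k : weq_count (k + m) (k + m) <
    (1 - eta) * N ^+ (m + m) * weq_count k k.
  by rewrite ltNge; apply/negP; exact: H.
have [eta1|eta1] := leP 1 eta.
  have := H 0%N; apply/negP; rewrite -leNgt.
  apply: le_trans (weq_count_ge0 _ _); rewrite mulr_le0_ge0 ?weq_count_ge0//.
  by rewrite mulr_le0_ge0 ?subr_le0// exprn_ge0// ltW.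
(* Bernoulli: [(1 - a) ^+ (m + m) >= 1 - eta]. *)
pose a := eta / (m + m)%:R.
have mm : 1 <= (m + m)%:R :> R by rewrite ler1n addn_gt0 m0.
have mm0 : 0 < (m + m)%:R :> R by rewrite (lt_le_trans _ mm).
have a0 : 0 < a by rewrite divr_gt0.
have a1 : a < 1 by rewrite ltr_pdivrMr// mul1r (lt_le_trans eta1).
pose p := (1 - a) * N.
have p0 : 0 < p by rewrite mulr_gt0// subr_gt0.
have pN : p < N by rewrite gtr_pMl// gtrBl.
have Hp k : weq_count (k + m) (k + m) <= (p ^+ 2) ^+ m * weq_count k k.
  apply: le_trans (ltW (H k)) _; rewrite ler_wpM2r ?weq_count_ge0//.
  rewrite -exprM mulnC muln2 -addnn exprMn ler_wpM2r ?exprn_ge0 ?(ltW N0)//.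
  apply: le_trans (bernoulli_ineq _ _); last by rewrite lerN2 ltW.
  by rewrite mulrN /a mulrC divfK// gt_eqF.
have [C C0 CP] := @geometric_bound R (fun k => weq_count k k) m _ m0
  (exprn_gt0 2 p0) (fun k => weq_count_ge0 k k) Hp.
have dC i j : weq_count i j <= C * p ^+ (i + j).
  (* This weight balances the two terms, which both become [C * p ^+ (i + j)]. *)
  have ti : 0 < p ^+ j / p ^+ i by rewrite divr_gt0 ?exprn_gt0.
  have := weq_count_AMGM i j ti.
  have h1 : p ^+ j / p ^+ i * weq_count i i <= C * p ^+ (i + j).
    apply: le_trans (ler_wpM2l (ltW ti) (CP i)) _.
    rewrite le_eqVlt; apply/orP; left; apply/eqP.
    by rewrite -exprM mulnC muln2 -addnn !exprD; field; rewrite expf_neq0// gt_eqF.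
  have h2 : (p ^+ j / p ^+ i)^-1 * weq_count j j <= C * p ^+ (i + j).
    have ti' : 0 <= (p ^+ j / p ^+ i)^-1 by rewrite invr_ge0 ltW.
    apply: le_trans (ler_wpM2l ti' (CP j)) _.
    rewrite le_eqVlt; apply/orP; left; apply/eqP.
    rewrite -exprM mulnC muln2 -addnn !exprD; field.
    by rewrite !expf_neq0// gt_eqF.
  lra.
suff gamC n : 0 <= gam n <= n.+1%:R * C * p ^+ n.
  by have := limn_esup_root_lt p0 pN C0 gamC; rewrite limN ltxx.
have /andP[-> /le_trans] := gamP n; apply.
rewrite (_ : _ * C * _ = \sum_(i < n.+1) C * p ^+ n); last first.
  by rewrite sumr_const card_ord -mulrA mulr_natl.
apply: ler_sum => i _; apply: le_trans (dC _ _) _.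
by rewrite subnKC// -ltnS.
Qed.

Hypothesis regS : regular S.

Lemma eq_translate_cat K z p u v w w' : resolves K z ->
  (size u + size w <= K)%N -> (size v + size w' <= K)%N ->
  (translate z (p ++ u) w == translate z (p ++ v) w') = (translate z u w == translate z v w').
Proof.
move=> zK uK vK; rewrite /translate -!catA !(wact_cat g p); apply/eqP/eqP => [e|-> //].
apply: zK; rewrite ?size_cat//; apply: (weq_cancel revS regS (u := p)).
by exists z; rewrite !(wact_cat g p).
Qed.

(** Left translations are isometries. *)
Lemma translate_coinc_cat K z p u v k : resolves K z ->
  (size u + k <= K)%N -> (size v + k <= K)%N ->
  coinc R (words X k) (words X k) (translate z (p ++ u)) (translate z (p ++ v)) =
  coinc R (words X k) (words X k) (translate z u) (translate z v).
Proof.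
move=> zK uK vK; rewrite /coinc big_seq [RHS]big_seq; apply: eq_bigr => w wk.
rewrite big_seq [RHS]big_seq; apply: eq_bigr => w' w'k.
move: wk w'k; rewrite !mem_words => /eqP wk /eqP w'k.
by rewrite (eq_translate_cat _ zK) ?wk ?w'k.
Qed.

Lemma translate_coinc_self K z u k : resolves K z -> (k <= K)%N ->
  coinc R (words X k) (words X k) (translate z u) (translate z u) = weq_count k k.
Proof.
move=> zK kK; rewrite -{1 2}(cats0 u) (translate_coinc_cat _ zK)//.
by rewrite (weq_countE zK).
Qed.

(** The squared norm of [f_(m+k)] is the sum of the inner products of all pairs
of translates of [f_k].  None of them exceeds [weq_count k k], so a single one
cannot fall short by more than the whole sum does. *)
Lemma translate_coinc_large z m k (t : R) u v : resolves (m + k) z ->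
  (#|X|%:R ^+ (m + m) - t ^+ 2) * weq_count k k <= weq_count (m + k) (m + k) ->
  u \in words X m -> v \in words X m ->
  (1 - t ^+ 2) * weq_count k k <=
    coinc R (words X k) (words X k) (translate z u) (translate z v).
Proof.
move=> zK large um vm; pose B u v := coinc R (words X k) (words X k) (translate z u) (translate z v).
have Bself w : B w w = weq_count k k by rewrite /B (translate_coinc_self _ zK)// leq_addl.
have Ble w w' : B w w' <= weq_count k k.
  have := coinc_AMGM (words X k) (words X k) (translate z w) (translate z w') (@ltr01 R).
  by rewrite -/(B w w) -/(B w' w') -/(B w w') !Bself invr1; lra.
have BE : weq_count (m + k) (m + k) =
    \sum_(w <- words X m) \sum_(w' <- words X m) B w w'.
  rewrite (weq_countE zK)// big_words_cat; apply: eq_bigr => w _.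
  rewrite /B /coinc [RHS]exchange_big /=; apply: eq_bigr => x _.
  by rewrite big_words_cat.
have : weq_count k k - B u v <= \sum_(w <- words X m) \sum_(w' <- words X m)
    (weq_count k k - B w w').
  rewrite (bigD1_seq u um (words_uniq _ _))/= (bigD1_seq v vm (words_uniq _ _))/=.
  rewrite -addrA lerDl addr_ge0//.
    by apply: sumr_ge0 => w _; rewrite subr_ge0.
  by do 2!apply: sumr_ge0 => ? _; rewrite subr_ge0.
under eq_bigr do rewrite sumrB.
rewrite sumrB -BE !big_const_seq !count_predT !iter_addr_0 size_words.
rewrite -mulrnA -expnD -mulr_natl natrX.
move: large; rewrite -/(B u v); lra.
Qed.

End CoincidenceCounts.

(** * Almost invariant finitely additive probabilities *)

Section AlmostInvariant.
Variables (R : realType) (T I : eqType) (r : seq I).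

Lemma coinc_in_ge0 (a : I -> T) (Y : set T) : 0 <= coinc_in R r a Y.
Proof. by do 2!apply: sumr_ge0 => ? _; rewrite mulr_ge0. Qed.

Lemma coinc_inT (a : I -> T) : coinc_in R r a [set: T] = coinc R r r a a.
Proof.
by do 2!apply: eq_bigr => ? _; rewrite asboolT ?mulr1.
Qed.

Lemma coinc_inU (a : I -> T) (A B : set T) : A `&` B = set0 ->
  coinc_in R r a (A `|` B) = coinc_in R r a A + coinc_in R r a B.
Proof.
move=> AB; rewrite /coinc_in -big_split; apply: eq_bigr => i _ /=.
rewrite -big_split; apply: eq_bigr => j _ /=; rewrite -mulrDr; congr (_ * _).
have [Aai|nA] := pselect (A (a i)).
  rewrite (asboolT (or_introl Aai : (A `|` B) _)) (asboolT Aai) asboolF ?addr0//.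
  by move=> Bai; have : (A `&` B) (a i) by []; rewrite AB.
rewrite (asboolF nA) add0r; congr ((_ : bool)%:R); apply: asbool_equiv_eq.
by split => [[]//|]; right.
Qed.

End AlmostInvariant.

(** One translate of the average of the translates by [x0^i], [i < m], differs
from it by [m] errors between words of equal length and one error between
[x0^m] and the empty word. *)
Lemma exists_almost_invariant (R : realType) (S : semigroupType) (X : finType)
    (g : X -> S) (e : seq X) (s0 : S) (tau : R) :
  left_reversible S -> regular S ->
  e != [::] -> (forall w, weq g (e ++ w) w) ->
  (forall m eta, (0 < m)%N -> 0 < eta ->
    exists k, (1 - eta) * #|X|%:R ^+ (m + m) * weq_count R g k k <=
      weq_count R g (k + m) (k + m)) ->
  0 < tau ->
  exists th : set S -> R, finitely_additive_probability th /\
    forall x Y, `|th ((fun s => (g x * s)%g) @^-1` Y) - th Y| <= tau.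
Proof.
move=> revS regS e0 eP norming tau0; pose m := size e.
have m0 : (0 < m)%N by rewrite lt0n size_eq0.
have [x0 _] : exists x0 : X, true by case: (e) e0 => // x; exists x.
have X0 : (0 < #|X|)%N by apply/card_gt0P; exists x0.
pose N : R := #|X|%:R; have N0 : 0 < N by rewrite ltr0n.
have NX0 : 0 < N ^+ (m + m) by rewrite exprn_gt0.
(* An error of [3 * t * c] for each of [m + 1 <= 2 * m] comparisons. *)
pose t := tau / 6; have t0 : 0 < t by rewrite divr_gt0.
have eta0 : 0 < t ^+ 2 / N ^+ (m + m) by rewrite divr_gt0// exprn_gt0.
have [k kP] := norming m _ m0 eta0.
have {}kP : (N ^+ (m + m) - t ^+ 2) * weq_count R g k k <=
    weq_count R g (m + k) (m + k).
  suff <- : (1 - t ^+ 2 / N ^+ (m + m)) * N ^+ (m + m) = N ^+ (m + m) - t ^+ 2.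
    by rewrite (addnC m k).
  by rewrite mulrBl divfK ?mul1r// gt_eqF.
have [z zK] := @exists_resolves S X g revS s0 (m + k).
pose c := weq_count R g k k; have c0 : 0 < c by apply: weq_count_gt0.
pose a u := translate g z u.
pose M u := coinc_in R (words X k) (a u).
have selfE u : coinc R (words X k) (words X k) (a u) (a u) = c.
  by rewrite /a (translate_coinc_self R revS regS u zK)// leq_addl.
have close u v Y : (1 - t ^+ 2) * c <= coinc R (words X k) (words X k) (a u) (a v) ->
    `|M u Y - M v Y| <= 3 * t * c.
  by move=> uv; apply: (coinc_in_dist Y t0 _ _ uv).
have close_same u v Y : size u = size v -> (size u <= m)%N ->
    `|M u Y - M v Y| <= 3 * t * c.
  (* Prefixing both words by [p] brings them to length [m] and is an isometry. *)
  move=> uv um; apply: close; pose p := nseq (m - size u) x0.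
  have pu : p ++ u \in words X m by rewrite mem_words size_cat size_nseq subnK.
  have pv : p ++ v \in words X m by rewrite mem_words size_cat size_nseq -uv subnK.
  have := translate_coinc_large revS regS zK kP pu pv.
  by rewrite (translate_coinc_cat R revS regS p zK)// ?leq_add2r// -uv.
have close_unit Y : `|M (nseq m x0) Y - M [::] Y| <= 3 * t * c.
  apply: close; have xm : nseq m x0 \in words X m by rewrite mem_words size_nseq.
  have em : e \in words X m by rewrite mem_words.
  have := translate_coinc_large revS regS zK kP xm em.
  rewrite -/(a (nseq m x0)) /coinc => /le_trans; apply.
  apply: ler_sum => w _; rewrite big_seq [leRHS]big_seq; apply: ler_sum => w'.
  rewrite mem_words => /eqP w'k; rewrite /a /translate (zK (e ++ w') w')//.
  - by rewrite size_cat w'k.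
  - by rewrite w'k leq_addl.
have pull x u Y : (size u < m)%N -> M u ((fun s => (g x * s)%g) @^-1` Y) = M (x :: u) Y.
  move=> um; rewrite /M /coinc_in big_seq [RHS]big_seq; apply: eq_bigr => w.
  rewrite mem_words => /eqP wk; rewrite big_seq [RHS]big_seq.
  apply: eq_bigr => w'; rewrite mem_words => /eqP w'k; congr (_%:R * _).
  have uk : (size u + k <= m + k)%N by rewrite leq_add2r ltnW.
  by rewrite -(@eq_translate_cat S X g revS regS (m + k) z [:: x] u u) ?wk ?w'k.
pose th Y := (\sum_(i < m) M (nseq i x0) Y) / (m%:R * c).
have mc0 : 0 < m%:R * c by rewrite mulr_gt0// ltr0n.
exists th; split.
  split=> [A||A B AB].
  - by rewrite divr_ge0 ?(ltW mc0)//; apply: sumr_ge0 => i _; exact: coinc_in_ge0.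
  - rewrite /th (eq_bigr (fun=> c)); last by move=> i _; rewrite /M coinc_inT.
    by rewrite sumr_const card_ord -[c *+ m]mulr_natl divff// gt_eqF.
  - rewrite /th -mulrDl -big_split; congr (_ / _); apply: eq_bigr => i _.
    exact: coinc_inU.
move=> x Y; rewrite /th -mulrBl normrM (ger0_norm (_ : 0 <= (m%:R * c)^-1)); last first.
  by rewrite invr_ge0 ltW.
rewrite ler_pdivrMr//.
rewrite (eq_bigr (fun i : 'I_m => M (x :: nseq i x0) Y)); last first.
  by move=> i _; rewrite pull// size_nseq.
have tele : \sum_(i < m) M (nseq i x0) Y = \sum_(i < m) M (nseq i.+1 x0) Y
    - (M (nseq m x0) Y - M [::] Y).
  have := telescope_sumr (fun i => M (nseq i x0) Y) (leq0n m).
  rewrite big_mkord sumrB => /= <-; ring.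
have -> : \sum_(i < m) M (x :: nseq i x0) Y - \sum_(i < m) M (nseq i x0) Y =
    (M (nseq m x0) Y - M [::] Y) +
    \sum_(i < m) (M (x :: nseq i x0) Y - M (nseq i.+1 x0) Y).
  by rewrite tele [X in _ = _ + X]sumrB; ring.
apply: le_trans (ler_normD _ _) _.
have h1 : `|\sum_(i < m) (M (x :: nseq i x0) Y - M (nseq i.+1 x0) Y)| <= m%:R * (3 * t * c).
  apply: le_trans (ler_norm_sum _ _ _) _.
  rewrite mulr_natl -[in leRHS](card_ord m) -sumr_const; apply: ler_sum => i _.
  by apply: close_same; rewrite /= size_nseq.
have h2 := close_unit Y.
apply: le_trans (lerD h2 h1) _.
have : 1 <= m%:R :> R by rewrite ler1n.
have : 0 <= 3 * t * c by rewrite !mulr_ge0// ltW.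
have -> : tau = 6 * t by rewrite /t mulrC divfK.
move: (m%:R : R) => q; nra.
Qed.

(** * Passing to the limit *)

(** The image of an ultrafilter is an ultrafilter, and [[0, 1]] is compact. *)
Lemma ultrafilter_limit (R : realType) (U : set_system nat) (u : nat -> R) :
  UltraFilter U -> (forall n, 0 <= u n <= 1) -> cvg (u n @[n --> U]).
Proof.
move=> UU u01.
have UI : UltraFilter (u n @[n --> U]).
  split; first exact: fmap_proper_filter.
  move=> G GF sub; apply/seteqP; split => // A GA.
  have [//|nA] := @in_ultra_setVsetC _ U (u @^-1` A) UU.
  have : G (A `&` ~` A) by apply: filterI => //; exact: sub.
  by rewrite setICr => /filter_not_empty.
have := @segment_compact R 0 1; rewrite compact_ultra => /(_ _ UI)[].
  by apply: (@filterE nat U) => n /=; rewrite in_itv /= u01.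
by move=> l [_ /= ul]; apply/cvg_ex; exists l.
Qed.

Lemma exists_invariant_limit (R : realType) (S : semigroupType) (X : finType)
    (g : X -> S) :
  (forall tau : R, 0 < tau ->
    exists th : set S -> R, finitely_additive_probability th /\
    forall x Y, `|th ((fun s => (g x * s)%g) @^-1` Y) - th Y| <= tau) ->
  exists mu : set S -> R, finitely_additive_probability mu /\
    forall x Y, mu ((fun s => (g x * s)%g) @^-1` Y) = mu Y.
Proof.
move=> almost.
have /choice[th thP] (n : nat) : exists th : set S -> R,
    finitely_additive_probability th /\
    forall x Y, `|th ((fun s => (g x * s)%g) @^-1` Y) - th Y| <= n.+1%:R^-1.
  by apply: almost; rewrite invr_gt0.
(* A free ultrafilter, so that the errors vanish along it. *)
have [U [UU ooU]] := ultraFilterLemma (eventually_filter).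
have th01 Y n : 0 <= th n Y <= 1.
  have [[th0 th1 thU] _] := thP n; rewrite th0/= -th1.
  by rewrite -(setUv Y) thU ?setICr// lerDl.
have cv Y := ultrafilter_limit UU (th01 Y).
pose mu Y := lim (th n Y @[n --> U]).
exists mu; split; first split.
- by move=> A; apply: limr_ge; [exact: cv | apply: filterE => n; case/andP: (th01 A n)].
- apply: cvg_lim => //; rewrite (_ : (fun n => th n setT) = cst 1); last first.
    by apply/funext => n; have [[]] := thP n.
  exact: cvg_cst.
- move=> A B AB; apply: cvg_lim => //.
  rewrite (_ : (fun n => th n (A `|` B)) = (fun n => th n A + th n B)); last first.
    by apply/funext => n; have [[_ _ ->]] := thP n.
  by apply: cvgD; exact: cv.
move=> x Y; apply/eqP; rewrite -subr_eq0; apply/eqP.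
rewrite /mu -limB; [|exact: cv|exact: cv].
apply: cvg_lim => //.
apply: (cvg_trans (G := (th n (( fun s => (g x * s)%g) @^-1` Y) - th n Y) @[n --> \oo])).
  by move=> A /= ?; apply: ooU.
apply: norm_cvg0.
apply: (@squeeze_cvgr _ _ _ _ (cst 0) (fun n => n.+1%:R^-1)).
- apply: nearW => n; rewrite normr_ge0 /=; have [_] := thP n; exact.
- exact: cvg_cst.
- exact: cvg_harmonic.
Qed.

(** * Cogrowth of the semigroup *)

Section Cogrowth.
Variables (S : semigroupType) (X : finType).
Variable ev : {multiplicative free_semigroup X -> S}.

Definition generator (x : X) : S := ev (@FreeSemigroup X [:: x] isT).

Lemma wact_generator (w : free_semigroup X) s :
  wact generator (word w) s = (ev w * s)%g.
Proof.
case: w => w w0; elim: w w0 => [//|x [|y w] IHw] w0.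
  by rewrite /= /generator; congr (ev _ * _)%g; exact: val_inj.
have -> : FreeSemigroup w0 =
    (@FreeSemigroup X [:: x] isT * @FreeSemigroup X (y :: w) isT)%g.
  exact: val_inj.
by rewrite gmulfM -mulgA -IHw.
Qed.

Lemma weq_ev (u v : free_semigroup X) (s : S) :
  ev u = ev v -> weq generator (word u) (word v).
Proof. by move=> uv; exists s; rewrite !wact_generator uv. Qed.

(** Sorting the cogrowth pairs by the length of the first word; words equal in
[S] are equal in the group image. *)
Lemma global_cogrowth_le (R : realType) (s : S) n :
  (global_cogrowth ev n)%:R <=
  \sum_(i < n.+1) weq_count R generator i (n - i).
Proof.
pose L := [seq [seq p <- [seq (w, w') | w <- words X i, w' <- words X (n - i)]
  | `[< weq generator p.1 p.2 >] ] | i : 'I_n.+1].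
have -> : \sum_(i < n.+1) weq_count R generator i (n - i) = (size (flatten L))%:R.
  rewrite size_flatten sumnE big_map big_map natr_sum enumT; apply: eq_bigr => i _.
  rewrite size_filter -sum1_count natr_sum big_mkcond big_allpairs.
  by do 2!apply: eq_bigr => ? _ /=; case: `[< _ >].
rewrite ler_nat /global_cogrowth.
pose f (p : free_semigroup X * free_semigroup X) := (word p.1, word p.2).
rewrite -(size_map f); apply: uniq_leq_size.
  rewrite map_inj_uniq ?fset_uniq// => -[u v] [u' v'] [/val_inj -> /val_inj ->].
  by [].
move=> _ /mapP[p + ->]; rewrite in_fset_set ?inE; last exact: finite_cogrowth_pairs.
move=> [pn pe]; apply/flattenP.
have i_lt : (Defs.wlength p.1 < n.+1)%N by rewrite ltnS -pn leq_addr.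
exists [seq q <- [seq (w, w') | w <- words X (Ordinal i_lt),
    w' <- words X (n - Ordinal i_lt)] | `[< weq generator q.1 q.2 >] ].
  by apply/mapP; exists (Ordinal i_lt) => //; rewrite mem_enum.
rewrite mem_filter; apply/andP; split; first by apply/asboolP; exact: weq_ev.
apply/allpairsP; exists (f p); split => //=; rewrite mem_words//.
by rewrite -pn addKn.
Qed.

End Cogrowth.

Theorem corollary6p14 (R : realType) (S : semigroupType) (X : finType)
    (ev : {multiplicative free_semigroup X -> S})
    (S_nonempty : inhabited S)
    (S_left_reversible : left_reversible S)
    (S_regular : regular S)
    (X_generates : choice_of_generators ev)
    (S_maximal : maximal_global_cogrowth R ev) :
  left_amenable R S.
Proof.
have [s0] := S_nonempty.
have gen s : exists w, w != [::] /\ forall t, wact (generator ev) w t = (s * t)%g.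
  have [w <-] := X_generates s; exists (word w).
  by split; [rewrite -size_eq0 -lt0n word_gt0 | exact: wact_generator].
have X0 : (0 < #|X|)%N.
  have [[|x w] [// _ _]] := gen s0.
  by apply/card_gt0P; exists x.
have [e [e0 eP]] := weq_unit_word S_left_reversible S_regular gen s0.
have [tau tau0|mu [mu_prob mu_inv]] := @exists_invariant_limit R S X (generator ev).
  apply: (exists_almost_invariant s0 S_left_reversible S_regular e0 eP _ tau0).
  move=> m eta m0 eta0.
  apply: (weq_count_almost_norming S_left_reversible s0 X0 m0 eta0 _ S_maximal) => n.
  by rewrite ler0n /=; exact: global_cogrowth_le.
exists mu; split=> // a Y; have [w [_ wE]] := gen a.
rewrite (_ : _ @^-1` Y = wact (generator ev) w @^-1` Y); last first.
  by apply/funext => t /=; rewrite wE.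
elim: w {wE} Y => [//|x w IHw] Y.
exact: (etrans (IHw ((fun s => (generator ev x * s)%g) @^-1` Y)) (mu_inv x Y)).
Qed.
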